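(* Let $(W,d)$ be a metric space equipped with a directed graph $G=(V(G),E(G))$ such that $V(G)=W$, $\Delta=\{(s,s): s\in W\}\subseteq E(G)$, and $G$ has no parallel edges. Let $F:W\to CL(W)$ and $f:W\to W$ be maps and let $k\in U$. Suppose that for all $v,w\in W$ with $fw\in Fv$ and $(fv,fw)\in E(G)$ the following hold: (i) $D(fw,Fw)\le k(d(fv,fw))\,d(fv,fw)$; (ii) for any $p\in W$ with $fp\in Fw$ and $d(fw,fp)\le d(fv,fw)$, one has $(fw,fp)\in E(G)$. Suppose that there are $w_0\in W$ and $p_0\in F(w_0)$ with $(fw_0,p_0)\in E(G)$. Assume also that whenever $(u_n)_n$ is a sequence in $W$ and $u\in W$ are such that $(fu_{n-1},fu_n)\in E(G)$ and $fu_n\in Fu_{n-1}$ for every $n\in\mathbb{N}$, and $fu_n\to fu$, there is a subsequence $(fu_{n_r})_{r}$ of $(fu_n)_n$ such that $D(fu,Fu)\le \liminf_{r\to\infty} D(fu_{n_r},Fu_{n_r})$. If $Fu\subset fW$ for each $u\in W$ and $(fW,d)$ is complete, then there is a sequence $(fw_n)_n$ with $fw_n\in Fw_{n-1}$ for every $n$ which converges to $fw^*$ for some $w^*\in W$ with $fw^*\in Fw^*$. Moreover, $f$ and $F$ possess a common fixed point whenever $f$ is $F$-weakly commuting at $w^*$ and $fw^*=ffw^*$.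
   Context: For a metric space $(W,d)$, $CL(W)$ is the collection of all nonempty closed subsets of $W$. For $u\in W$ and nonempty $Z\subseteq W$, $D(u,Z)=\inf_{v\in Z}d(u,v)$. $U$ is the set of functions $h:[0,\infty)\to[0,1)$ such that $\limsup_{r\to t^+}h(r)<1$ for every $t\in[0,\infty)$. $fw$ means $f(w)$, $ffw$ means $f(f(w))$, $Fw$ means $F(w)$, and $fW=f(W)$. The map $f$ is $F$-weakly commuting at $z\in W$ if $ffz\in Ffz$, i.e. $f(f(z))\in F(f(z))$. A common fixed point of $f$ and $F$ is a point $a\in W$ with $a=fa\in Fa$. *)

(* Defs.v *)
From HB Require Import structures.
From mathcomp Require Export all_boot all_order all_algebra.
From mathcomp Require Export all_classical all_reals.
From mathcomp Require Export ereal topology normedtype sequences.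

Set Implicit Arguments.
Unset Strict Implicit.
Unset Printing Implicit Defensive.

Import Order.TTheory GRing.Theory Num.Theory.
Import numFieldNormedType.Exports.

Local Open Scope classical_set_scope.
Local Open Scope ring_scope.

(* The edges form a set of ordered pairs, so that parallel edges are excluded
   by construction. *)
Record digraph (T : Type) := Digraph {
  vertices : set T;
  edges : set (T * T);
  edges_vertices : edges `<=` vertices `*` vertices
}.

Definition CL (W : topologicalType) : set (set W) :=
  [set A | A !=set0 /\ closed A].

(* [inf] has the junk value 0 on the empty set; [dist_set] is meant to be used
   with nonempty [Z]. *)
Definition dist_set (R : realType) (W : metricType R) (u : W) (Z : set W) : R :=
  inf [set mdist u v | v in Z].

(* A function [0, +oo[ -> [0, 1[ is represented by a function on R whose values
   at negative arguments are irrelevant. The filter [t^'+] is that of the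
   punctured right neighborhoods of [t]. *)
Definition classU (R : realType) : set (R -> R) :=
  [set h : R -> R | (forall t : R, 0 <= t -> 0 <= h t < 1) /\
           (forall t : R, 0 <= t -> (limf_esup (EFin \o h) t^'+ < 1)%E)].

Definition complete_set (R : realType) (W : metricType R) (A : set W) : Prop :=
  forall x : nat -> W, (forall n, A (x n)) -> cauchy (x @ \oo) ->
    exists2 l, A l & x @ \oo --> l.

Definition weakly_commuting_at (W : Type) (f : W -> W) (F : W -> set W)
  (z : W) : Prop := F (f z) (f (f z)).

Definition common_fixed_point (W : Type) (f : W -> W) (F : W -> set W)
  (a : W) : Prop := a = f a /\ F a (f a).

(* Main.v *)
Require Import Defs.
From mathcomp Require Import all_boot all_order all_algebra.
From mathcomp Require Import all_classical all_reals.
From mathcomp Require Import ereal topology normedtype sequences.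
From mathcomp Require Import lra.

Import Order.TTheory GRing.Theory Num.Theory.
Import numFieldNormedType.Exports.

Local Open Scope classical_set_scope.
Local Open Scope ring_scope.

(* Choose [w n.+2] with [f (w n.+2)] in [F (w n.+1)] and
   [a n.+1 <= (k (a n) + 1) / 2 * a n], where [a n := d (f (w n)) (f (w n.+1))];
   as the factor is below 1, the edge condition propagates along the sequence.
   Then [a] decreases to some [t], and since [k] is bounded away from 1 both at
   [t] and on a right neighborhood of [t], eventually [a n.+1 <= c * a n] with
   [c < 1]. Hence [f \o w] is Cauchy, and
   [D (f (w n)) (F (w n)) <= a n --> 0] together with lower semicontinuity
   forces [D (f wstar) (F wstar) = 0]. *)

Lemma dist_set_has_lbound (R : realType) (W : metricType R) (u : W)
  (Z : set W) : has_lbound [set mdist u v | v in Z].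
Proof. by exists 0 => _ [v _ <-]; exact: mdist_ge0. Qed.

Lemma dist_set_le (R : realType) (W : metricType R) (u v : W) (Z : set W) :
  Z v -> dist_set u Z <= mdist u v.
Proof. by move=> Zv; apply: (ge_inf (dist_set_has_lbound _ _ u Z)); exists v. Qed.

Lemma dist_set_ge0 (R : realType) (W : metricType R) (u : W) (Z : set W) :
  Z !=set0 -> 0 <= dist_set u Z.
Proof.
move=> [z Zz]; apply: lb_le_inf; first by exists (mdist u z), z.
by move=> _ [v _ <-]; exact: mdist_ge0.
Qed.

Lemma dist_set_lt (R : realType) (W : metricType R) (u : W) (Z : set W)
  (e : R) : Z !=set0 -> dist_set u Z < e -> exists2 v, Z v & mdist u v < e.
Proof.
move=> [z Zz] /inf_lt[|_ [v Zv <-] lt_v]; last by exists v.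
by exists (mdist u z), z.
Qed.

Lemma dist_set_le0 (R : realType) (W : metricType R) (u : W) (Z : set W) :
  CL Z -> dist_set u Z <= 0 -> Z u.
Proof.
move=> [Z0 clZ] dZ; apply: clZ => B /nbhs_ballP[e /= e0 eB].
have [v Zv uv] := dist_set_lt _ _ _ _ _ Z0 (le_lt_trans dZ e0).
by exists v; split=> //; apply: eB; rewrite ballEmdist.
Qed.

(** The limsup bounds [h] only strictly to the right of [t], since [t^'+] is punctured; the value
    [h t < 1] is brought in by a maximum. The point [t] must be covered because a nonincreasing
    sequence may attain its limit. *)
Lemma classU_le_near_right (R : realType) (h : R -> R) (t : R) :
  classU h -> 0 <= t ->
  exists2 c, 0 <= c < 1 & exists2 e, 0 < e & forall r, t <= r < t + e -> h r <= c.
Proof.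
move=> [h01 hsup] t0; have := hsup _ t0.
rewrite /limf_esup => /ereal_inf_lt[_ [V tV <-] V1].
have [M M1 VM] : exists2 M : R, M < 1 & forall r, V r -> h r <= M.
  have VP r : V r -> ((h r)%:E <= ereal_sup ((EFin \o h) @` V))%E.
    by move=> Vr; apply: ereal_sup_ubound; exists r.
  case: (ereal_sup _) V1 VP => [M| |]//.
    by rewrite lte_fin => M1 VP; exists M => // r /VP; rewrite lee_fin.
  (* A supremum equal to [-oo] forces [V] to be empty, so any bound below 1 serves. *)
  by move=> _ VP; exists 0 => // r /VP.
move: tV => [e /= e0 eV]; have /andP[ht0 ht1] := h01 _ t0.
exists (Num.max (h t) M); first by rewrite le_max ht0 gt_max ht1.
exists e => // r /andP[]; rewrite le_eqVlt => /orP[/eqP<- _|tr re].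
  by rewrite le_max lexx.
rewrite le_max VM ?orbT//; apply: eV => //=.
by rewrite distrC gtr0_norm ?subr_gt0// ltrBlDl.
Qed.

Lemma classU_iterate_contracts (R : realType) (h : R -> R) (a : nat -> R) :
  classU h -> (forall n, 0 <= a n) ->
  (forall n, a n.+1 <= (h (a n) + 1) / 2 * a n) ->
  exists2 c, 0 <= c < 1 & \forall n \near \oo, a n.+1 <= c * a n.
Proof.
move=> hU a0 ah.
have a_noninc : nonincreasing_seq a.
  apply/nonincreasing_seqP => n; apply: le_trans (ah n) _.
  have /andP[_ h1] := hU.1 _ (a0 n).
  by rewrite ler_piMl ?a0//; lra.
have a_cvg : cvgn a.
  by apply: nonincreasing_is_cvgn => //; exists 0 => _ [n _ <-].
have t0 : 0 <= limn a by apply: limr_ge => //; exact: nearW.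
have [c /andP[c0 c1] [e e0 hc]] := classU_le_near_right _ _ _ hU t0.
exists ((c + 1) / 2); first by apply/andP; split; lra.
have : \forall n \near \oo, a n < limn a + e.
  by apply: cvgr_lt a_cvg _ _; rewrite ltrDl.
apply: filterS => n an; apply: le_trans (ah n) _.
rewrite ler_wpM2r ?a0//.
(* Monotonicity keeps [a n] at or above its limit, hence inside the one-sided interval where [c]
   bounds [h]. *)
have : h (a n) <= c by apply: hc; rewrite an nonincreasing_cvgn_ge.
by lra.
Qed.

Lemma contracting_cvg0 (R : realType) (a : nat -> R) (c : R) :
  0 <= c < 1 -> (forall n, 0 <= a n) ->
  (\forall n \near \oo, a n.+1 <= c * a n) -> a @ \oo --> 0.
Proof.
move=> /andP[c0 c1] a0 [N _ aN].
have aM m : a (m + N)%N <= a N * c ^+ m.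
  elim: m => [|m IH]; first by rewrite expr0 mulr1.
  rewrite addSn exprS mulrCA; apply: le_trans (aN _ _) _ => /=.
    exact: leq_addl.
  exact: ler_wpM2l.
rewrite -(cvg_shiftn N).
apply: (@squeeze_cvgr _ _ _ _ (cst 0) (geometric (a N) c) (fun m => a (m + N)%N)).
- by apply: nearW => m; rewrite a0 /=.
- exact: cvg_cst.
- by apply: cvg_geometric; rewrite ger0_norm.
Qed.

Lemma contracting_cauchy (R : realType) (W : metricType R) (x : nat -> W)
  (c : R) : 0 <= c < 1 ->
  (\forall n \near \oo,
     mdist (x n.+1) (x n.+2) <= c * mdist (x n) (x n.+1)) ->
  cauchy (x @ \oo).
Proof.
move=> c01 xc; have /andP[c0 c1] := c01.
pose a n := mdist (x n) (x n.+1).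
have a0 n : 0 <= a n by exact: mdist_ge0.
have a_cvg0 : a @ \oo --> 0 by exact: contracting_cvg0 xc.
case: xc => N _ xN.
(* This is the geometric-series bound [a n / (1 - c)] with the division cleared. The induction on
   [m] closes because [a n * (1 - c) + a n.+1 <= a n] as soon as [a n.+1 <= c * a n]. *)
have tail m n : (N <= n)%N -> mdist (x n) (x (n + m)%N) * (1 - c) <= a n.
  elim: m n => [|m IH] n Nn; first by rewrite addn0 mdistxx mul0r.
  have := IH _ (leqW Nn); have := xN _ Nn; rewrite -/(a _) -/(a _) addSnnS.
  have := metric_triangle (x n) (x n.+1) (x (n + m.+1)%N); rewrite -/(a n).
  by nra.
apply: cauchy_exP => e e0.
have : \forall n \near \oo, (N <= n)%N /\ a n < e * (1 - c).
  apply: filterI; first exact: nbhs_infty_ge.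
  by apply: cvgr_lt a_cvg0 _ _; rewrite mulr_gt0// subr_gt0.
move=> [M _ /(_ M (leqnn M)) [NM aM]].
exists (x M), M => // m /= Mm; rewrite ballEmdist /=.
have := tail (m - M)%N _ NM; rewrite subnKC// => xMm.
by rewrite -(@ltr_pM2r _ (1 - c)) ?subr_gt0//; exact: le_lt_trans aM.
Qed.

(* If [d := mdist (f v) (f w)] vanishes then [f w] lies in the closed set [F w]
   and [w] itself is a next point; otherwise [k d * d < (k d + 1) / 2 * d < d]
   leaves room for a point of [F w] that is close enough to [f w]. *)
Lemma next_iterate (R : realType) (W : metricType R) (F : W -> set W)
  (f : W -> W) (k : R -> R) (v w : W) :
  CL (F w) -> F w `<=` range f -> 0 <= k (mdist (f v) (f w)) < 1 ->
  dist_set (f w) (F w) <= k (mdist (f v) (f w)) * mdist (f v) (f w) ->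
  exists2 p, F w (f p) &
    mdist (f w) (f p) <= (k (mdist (f v) (f w)) + 1) / 2 * mdist (f v) (f w).
Proof.
set d := mdist _ _ => clF Ff /andP[k0 k1] dk.
have := mdist_ge0 (f v) (f w); rewrite -/d le_eqVlt => /predU1P[d0|d0].
  exists w; last by rewrite mdistxx -d0 mulr0.
  by apply: dist_set_le0 => //; rewrite (le_trans dk)// -d0 mulr0.
have [|q Fq lt_q] := dist_set_lt _ _ (f w) _ ((k d + 1) / 2 * d) clF.1.
  by rewrite (le_lt_trans dk)// ltr_pM2r//; lra.
have [p _ pq] := Ff _ Fq.
by exists p; rewrite pq// ltW.
Qed.

Theorem theorem3p1 (R : realType) (W : metricType R) (G : digraph W)
  (hV : vertices G = [set: W])
  (hdiag : [set (s, s) | s in [set: W]] `<=` edges G)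
  (F : W -> set W) (hF : forall w, CL (F w))
  (f : W -> W) (k : R -> R) (hk : classU k)
  (hcontr : forall v w : W, F v (f w) -> edges G (f v, f w) ->
    dist_set (f w) (F w) <= k (mdist (f v) (f w)) * mdist (f v) (f w))
  (hedge : forall v w : W, F v (f w) -> edges G (f v, f w) ->
    forall p : W, F w (f p) -> mdist (f w) (f p) <= mdist (f v) (f w) ->
      edges G (f w, f p))
  (w0 p0 : W) (hp0 : F w0 p0) (hw0 : edges G (f w0, p0))
  (hlsc : forall (u : nat -> W) (ustar : W),
    (forall n, edges G (f (u n), f (u n.+1))) ->
    (forall n, F (u n) (f (u n.+1))) ->
    (fun n => f (u n)) @ \oo --> f ustar ->
    exists r : nat -> nat, {homo r : m n / (m < n)%N} /\
      ((dist_set (f ustar) (F ustar))%:E <=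
        limn_einf (fun j => (dist_set (f (u (r j))) (F (u (r j))))%:E))%E)
  (hrange : forall u, F u `<=` range f)
  (hcomplete : complete_set (range f)) :
  exists (w : nat -> W) (wstar : W),
    [/\ w 0%N = w0,
        forall n, F (w n) (f (w n.+1)),
        (fun n => f (w n)) @ \oo --> f wstar,
        F wstar (f wstar) &
        weakly_commuting_at f F wstar -> f wstar = f (f wstar) ->
          exists a, common_fixed_point f F a].
Proof.
have [w1 _ fw1] := hrange _ _ hp0.
(* The choice of the next point depends on the last two, so the recursion runs on pairs; [linked] is
   the invariant under which [hcontr] and [hedge] apply. *)
pose linked (q : W * W) := F q.1 (f q.2) /\ edges G (f q.1, f q.2).
have [next nextP] : {next : W * W -> W & forall q, linked q ->
    linked (q.2, next q) /\
    mdist (f q.2) (f (next q)) <=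
      (k (mdist (f q.1) (f q.2)) + 1) / 2 * mdist (f q.1) (f q.2)}.
  apply: (@choice _ _ (fun q p => linked q -> linked (q.2, p) /\
    mdist (f q.2) (f p) <=
      (k (mdist (f q.1) (f q.2)) + 1) / 2 * mdist (f q.1) (f q.2))).
  (* Pairs that are not linked receive the dummy value [v]. *)
  move=> [v w]; have [[/= Fvw Gvw]|] := pselect (linked (v, w)); last by exists v.
  have k01 := hk.1 _ (mdist_ge0 (f v) (f w)).
  have [p Fwp dwp] := next_iterate _ _ _ _ _ _ _ (hF w) (hrange w) k01
    (hcontr _ _ Fvw Gvw).
  exists p => _; split=> //; split=> //=; apply: hedge Fvw Gvw _ Fwp _.
  by apply: le_trans dwp _; rewrite ler_piMl ?mdist_ge0//; lra.
(* By computation [q n] is the pair [(w n, w n.+1)]. *)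
pose q n := iter n (fun q => (q.2, next q)) (w0, w1).
pose w n := (q n).1.
have linked_q n : linked (q n).
  by elim: n => [|n /nextP[]//]; split; rewrite /= fw1.
have Fw n : F (w n) (f (w n.+1)) by exact: (linked_q n).1.
have Gw n : edges G (f (w n), f (w n.+1)) by exact: (linked_q n).2.
pose a n := mdist (f (w n)) (f (w n.+1)).
have a0 n : 0 <= a n by exact: mdist_ge0.
have [c c01 ac] : exists2 c, 0 <= c < 1 & \forall n \near \oo, a n.+1 <= c * a n.
  by apply: (classU_iterate_contracts _ k) => // n; exact: (nextP _ (linked_q n)).2.
have [_ [wstar _ <-] fw_cvg] : exists2 l, range f l & (f \o w) @ \oo --> l.
  apply: hcomplete; first by move=> n; exists (w n).
  exact: contracting_cauchy c01 ac.
have Fwstar : F wstar (f wstar).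
  apply: dist_set_le0 => //; have [r [r_incr]] := hlsc _ _ Gw Fw fw_cvg.
  rewrite -lee_fin => /le_trans; apply.
  have D_cvg0 : (fun n => dist_set (f (w n)) (F (w n))) @ \oo --> (0 : R).
    apply: (@squeeze_cvgr _ _ _ _ (cst 0) a
      (fun n => dist_set (f (w n)) (F (w n)))).
    (* The upper bound [a n] holds because [f (w n.+1)] is a point of [F (w n)]. *)
    - by apply: nearW => n; rewrite dist_set_ge0 ?dist_set_le//; exact: (hF _).1.
    - exact: cvg_cst.
    - exact: contracting_cvg0 ac.
  (* A strictly increasing [r] satisfies [m <= r m]. *)
  have r_cvg : r @ \oo --> \oo.
    apply/cvgnyPge => n; exists n => // m /= nm; apply: leq_trans nm _.
    by elim: m => // m IH; exact: leq_ltn_trans IH (r_incr _ _ (ltnSn m)).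
  have Dr_cvg0 :
      (fun j => (dist_set (f (w (r j))) (F (w (r j))))%:E) @ \oo --> 0%E.
    apply: cvg_EFin; first exact: nearW.
    exact: cvg_comp r_cvg D_cvg0.
  by rewrite (cvg_limn_einf_sup Dr_cvg0).1.
exists w, wstar; split=> // wc fixed.
(* With [f wstar] as the point, the two requirements are literally [fixed] and [wc]. *)
by exists (f wstar).
Qed.
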